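(* There is a universal constant $C>0$ such that for every $\delta\in(0,1]$ and every $(2,\delta)$-LCC $C'\subseteq\mathbb{C}^m$ over $\mathbb{C}$, we have $\dim(C')\le C/\delta^9$.
   Context: Let $\mathbb{F}$ be a field. A $(q,\delta)$-LCC (linear locally correctable code) over $\mathbb{F}$ is a linear subspace $C'\subseteq\mathbb{F}^m$ for which there exists a randomized decoding procedure $D:\mathbb{F}^m\times[m]\to\mathbb{F}$ such that: (1) for all $x\in C'$, all $i\in[m]$ and all $v\in\mathbb{F}^m$ with $w(v)\le\delta m$ (where $w(v)$ is the number of non-zero coordinates of $v$), $D(x+v,i)=x_i$ with probability at least $3/4$ over the internal randomness of $D$; (2) for every $y\in\mathbb{F}^m$ and $i\in[m]$, $D(y,i)$ reads at most $q$ positions of $y$. The dimension of the LCC is its dimension as a subspace of $\mathbb{F}^m$. *)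

(* Defs.v *)
From HB Require Import structures.
From mathcomp Require Import all_boot all_order all_algebra.
From mathcomp Require Import complex.
From mathcomp Require Import all_classical all_reals all_analysis.

Set Implicit Arguments.
Unset Strict Implicit.
Unset Printing Implicit Defensive.

Import Order.TTheory GRing.Theory Num.Theory.
Local Open Scope classical_set_scope.
Local Open Scope ring_scope.

(* A deterministic algorithm with oracle access to the [m] coordinates of a
   word.  Reads are adaptive: the continuation after reading a coordinate
   depends on the value found there. *)
Inductive query_alg (F : Type) (m : nat) : Type :=
| Output of F
| Read of 'I_m & (F -> query_alg F m).

Fixpoint run (F : Type) (m : nat) (t : query_alg F m) (y : 'rV[F]_m) : F :=
  match t with
  | Output a => a
  | Read j k => run (k (y ord0 j)) y
  end.

Fixpoint positions_read (F : Type) (m : nat) (t : query_alg F m)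
    (y : 'rV[F]_m) : {set 'I_m} :=
  match t with
  | Output _ => finset.set0
  | Read j k => (j |: positions_read (k (y ord0 j)) y)%SET
  end.

Definition weight (F : fieldType) (m : nat) (v : 'rV[F]_m) : nat :=
  #|[set j : 'I_m | v ord0 j != 0]%SET|.

(* The internal randomness of the decoder is a point [w] of an arbitrary
   probability space; once [w] is drawn, decoding the coordinate [i] is the
   deterministic algorithm [D i w].  The library's measures are total functions
   on sets, so the success event has to be required to be measurable for its
   probability to be meaningful. *)
Definition is_LCC (R : realType) (F : fieldType) (m q : nat) (delta : R)
    (C : {vspace 'rV[F]_m}) : Prop :=
  exists (d : measure_display) (T : measurableType d) (P : probability T R)
         (D : 'I_m -> T -> query_alg F m),
    (forall (x : 'rV[F]_m) (i : 'I_m) (v : 'rV[F]_m),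
       x \in C -> (weight v)%:R <= delta * m%:R ->
       let success := [set w : T | run (D i w) (x + v) = x ord0 i] in
       measurable success /\ ((3%:R / 4%:R)%:E <= P success)%E) /\
    (forall (y : 'rV[F]_m) (i : 'I_m) (w : T),
       (#|positions_read (D i w) y| <= q)%N).

(* Main.v *)
(** A decoder that errs with probability at most 1/4 forces, for every coordinate
    [i] and every small set [S], a set [Q] of at most two coordinates outside [S]
    that determines coordinate [i] on the code: otherwise a random codeword,
    erased on [S], would defeat it.  View coordinates as vectors (functionals on
    the code) and call a nonzero vector's parallel class its multiplicity.  A
    vector of small multiplicity lies on many lines on which its own class is not
    dominant, so, giving a dependent triple the inverse size of its line as
    weight, there is a quadratic total weight of triples although each pair of
    coordinates carries weight at most 1.  A subset [V] of the coordinates that is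
    extremal for this weight has large degree at each of its points.

    The code restricted to [V] is killed by a matrix whose rows have three nonzero
    entries.  Over the complex numbers its columns can be rescaled so that, with
    rows normalized, all column norms are large; orthogonality of the columns up
    to small error then bounds the dimension of the kernel.  Passing to the
    subcode vanishing on [V] and iterating until no coordinate is left spends a
    bounded dimension per coordinate.  This gives the bound with [delta ^- 4]. *)

Require Import Defs.
From HB Require Import structures.
From mathcomp Require Import all_boot all_order all_algebra.
From mathcomp Require Import complex.
From mathcomp Require Import all_classical all_reals all_analysis.
From mathcomp Require Import measurable_realfun zify ring lra.

Set Implicit Arguments.
Unset Strict Implicit.
Unset Printing Implicit Defensive.

Import Order.TTheory GRing.Theory Num.Theory.
Local Open Scope ring_scope.

(** * From decoders to determining pairs *)

Lemma run_eq_on (F : Type) (m : nat) (t : query_alg F m) (y z : 'rV[F]_m) :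
  (forall j, j \in positions_read t y -> y ord0 j = z ord0 j) ->
  run t y = run t z /\ positions_read t y = positions_read t z.
Proof.
elim: t => [a|j k IH] //= eq_yz.
have eqj : y ord0 j = z ord0 j by apply: eq_yz; rewrite in_setU1 eqxx.
rewrite -eqj.
have [j' j'P|-> ->] := IH (y ord0 j); last by [].
by apply: eq_yz; rewrite in_setU1 j'P orbT.
Qed.

(** * Counting the combinations that one deterministic decoder recovers *)

Section RandomCodeword.
Variables (F : numFieldType) (m q : nat) (S : {set 'I_m}) (i : 'I_m).
Variables (N : nat) (u : {set 'I_m} -> 'rV[F]_m).

Hypothesis u_i : forall Q : {set 'I_m}, (#|Q| <= q)%N -> u Q ord0 i = 1.
Hypothesis u_Q : forall (Q : {set 'I_m}) j, (#|Q| <= q)%N -> j \in Q -> j \notin S ->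
  u Q ord0 j = 0.

(** A uniform count over [c] stands for a random codeword. In characteristic zero the multiples of a
    nonzero entry by distinct naturals are distinct, so [N] may be as large as wished. *)
Definition combination (c : {ffun {set 'I_m} -> 'I_N}) : 'rV[F]_m :=
  \sum_Q u Q *+ c Q.

Definition erase (x : 'rV[F]_m) : 'rV[F]_m :=
  \row_j (if j \in S then 0 else x ord0 j).

Variable t : query_alg F m.
Hypothesis t_reads : forall y, (#|positions_read t y| <= q)%N.

Definition lucky : {set {ffun {set 'I_m} -> 'I_N}} :=
  [set c | run t (erase (combination c)) == combination c ord0 i]%SET.

Definition lucky_at Q : {set {ffun {set 'I_m} -> 'I_N}} :=
  [set c in lucky | positions_read t (erase (combination c)) == Q]%SET.

Lemma combinationB (Q : {set 'I_m}) (c c' : {ffun {set 'I_m} -> 'I_N}) :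
  (forall Q', Q' != Q -> c Q' = c' Q') ->
  combination c - combination c' = u Q *+ c Q - u Q *+ c' Q.
Proof.
move=> eqc; rewrite /combination -sumrB (bigD1 Q) //= big1 ?addr0 // => Q' nQ.
by rewrite eqc // subrr.
Qed.

(* Along the direction [u Q] the positions in [Q] stay constant while the
   coordinate [i] moves, so at most one point of each such line is lucky. *)
Lemma lucky_at_inj (Q : {set 'I_m}) (c c' : {ffun {set 'I_m} -> 'I_N}) :
  c \in lucky_at Q -> c' \in lucky_at Q ->
  (forall Q', Q' != Q -> c Q' = c' Q') -> c = c'.
Proof.
rewrite !inE => /andP[/eqP rc /eqP Qc] /andP[/eqP rc' /eqP Qc'] eqc.
have Qq : (#|Q| <= q)%N by rewrite -Qc.
have eqB := combinationB eqc.
have [|eqr _] := @run_eq_on _ _ t (erase (combination c))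
  (erase (combination c')).
  move=> j; rewrite Qc !mxE => jQ; case: ifPn => // jS.
  apply/eqP; rewrite -subr_eq0; have := congr1 (fun x : 'rV_m => x ord0 j) eqB.
  by rewrite !mxE => ->; rewrite !mulmxnE u_Q // !mul0rn subrr.
have := congr1 (fun x : 'rV_m => x ord0 i) eqB.
rewrite !mxE !mulmxnE u_i // -[in LHS]rc -rc' eqr subrr => /esym/eqP.
rewrite subr_eq0 eqr_nat => /eqP/val_inj eqQ.
by apply/ffunP => Q'; have [->|/eqc] := eqVneq Q' Q.
Qed.

Lemma card_lucky_at Q :
  (#|lucky_at Q| * N <= #|{ffun {set 'I_m} -> 'I_N}|)%N.
Proof.
have -> : (#|lucky_at Q| * N = #|finset.setX (lucky_at Q) [set: 'I_N]%SET|)%N.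
  by rewrite cardsX cardsT card_ord.
(* [f] moves a point along its line in direction [u Q]. At most one point of that line is in
   [lucky_at Q], so the original pair is recovered from the image. *)
pose f (p : {ffun {set 'I_m} -> 'I_N} * 'I_N) :=
  [ffun Q' => if Q' == Q then p.2 else p.1 Q'].
rewrite -(@card_in_imset _ _ f) ?max_card // => -[c s] [c' s'].
rewrite !finset.inE /= !andbT => cl cl' /ffunP eqf.
have <- : s = s' by have := eqf Q; rewrite !ffunE eqxx.
congr pair; apply: lucky_at_inj; rewrite ?inE; [exact: cl|exact: cl'|].
by move=> Q' /negPf nQ; have := eqf Q'; rewrite !ffunE nQ.
Qed.

(** Summing over the possible read sets costs only a factor independent of [N]; for large [N] a
    deterministic decoder succeeds on a small fraction. *)
Lemma card_lucky :
  (#|lucky| * N <= #|{set 'I_m}| * #|{ffun {set 'I_m} -> 'I_N}|)%N.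
Proof.
rewrite -sum1_card (partition_big
  (fun c => positions_read t (erase (combination c))) xpredT) //=.
rewrite big_distrl /= -sum_nat_const; apply: leq_sum => Q _.
rewrite sum1_card; apply: leq_trans (card_lucky_at Q).
rewrite leq_mul2r; apply/orP; right; apply: subset_leq_card.
by apply/fintype.subsetP => c; rewrite unfold_in => Hc; rewrite finset.inE.
Qed.

End RandomCodeword.

(** The sum of the probabilities is the expected number of events that occur, and that number never
    exceeds [M]. *)
Lemma sum_probability_le (R : realType) (d : measure_display)
    (T : measurableType d) (P : probability T R) (I : finType)
    (A : I -> set T) (M : nat) :
  (forall c, measurable (A c)) ->
  (forall w, (\sum_c (w \in A c) <= M)%N) ->
  (\sum_c P (A c) <= M%:R%:E)%E.
Proof.
move=> mA leM.
have -> : (\sum_c P (A c) =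
    \int[P]_(x in [set: T]%classic) \sum_c (\1_(A c) x)%:E)%E.
  rewrite ge0_integral_sum //.
    by apply: eq_bigr => c _; rewrite integral_indic // setIT.
  by move=> c; apply/measurable_EFinP; exact: measurable_indic.
rewrite -[leRHS]mule1 -(probability_setT P) -integral_cst //.
apply: ge0_le_integral => //.
- by move=> x _; apply: sume_ge0.
- apply: emeasurable_sum => c.
  by apply/measurable_EFinP; exact: measurable_indic.
- move=> x _ /=; rewrite sumEFin lee_fin.
  rewrite (eq_bigr (fun c => (nat_of_bool (x \in A c))%:R)) => [|c _].
    by rewrite -natr_sum ler_nat.
  by rewrite indicE.
Qed.

Lemma LCC_determines (R : realType) (F : numFieldType) (m q : nat) (delta : R)
    (C : {vspace 'rV[F]_m}) : is_LCC q delta C ->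
  forall (i : 'I_m) (S : {set 'I_m}), #|S|%:R <= delta * m%:R ->
  exists Q : {set 'I_m}, [/\ (#|Q| <= q)%N, [disjoint Q & S] &
    forall x, x \in C -> (forall j, j \in Q -> x ord0 j = 0) -> x ord0 i = 0].
Proof.
move=> [d [T [P [D [decP readP]]]]] i S leS.
apply: contrapT => noQ.
have exu (Q : {set 'I_m}) : exists v : 'rV[F]_m, v \in C /\ ((#|Q| <= q)%N ->
    v ord0 i = 1 /\ forall j, j \in Q -> j \notin S -> v ord0 j = 0).
  (* If every codeword vanishing on [Q :\: S] vanished at [i], then [Q :\: S] would be the
     determining set that is assumed not to exist. *)
  case: (leqP #|Q| q) => [leQ|_]; last by exists 0; rewrite mem0v.
  apply: contrapT => nov; apply: noQ; exists (Q :\: S)%SET; split.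
  - by rewrite (leq_trans _ leQ) // subset_leq_card ?subsetDl.
  - by apply/pred0P => j /=; rewrite finset.inE; case: (j \in S); rewrite ?andbF.
  move=> x xC x0; apply/eqP; apply: contrapT => /negP xi; apply: nov.
  exists ((x ord0 i)^-1 *: x); split; first by rewrite memvZ.
  move=> _; split=> [|j jQ jS]; first by rewrite mxE mulVf.
  have jQS : j \in (Q :\: S)%SET by rewrite finset.inE jS.
  by rewrite mxE (x0 j) ?mulr0.
have [u uP] := choice exu.
(* Twice the number of read sets: each outcome of the randomness then succeeds on at most half of
   the combinations, against an average of at least 3/4. *)
pose N := (2 * #|{set 'I_m}|)%N.
pose X := @combination F m N u.
have XC c : X c \in C.
  by apply: memv_suml => Q _; rewrite rpredMn //; case: (uP Q).
have succ c : let A := [set w : T | run (D i w) (erase S (X c)) = X c ord0 i]%classic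
    in measurable A /\ ((3%:R / 4%:R)%:E <= P A)%E.
  (* Erasing is adding an error vector supported on [S]. *)
  have := decP (X c) i (erase S (X c) - X c) (XC c).
  rewrite subrKC; apply; apply: le_trans leS; rewrite ler_nat.
  apply: subset_leq_card; apply/fintype.subsetP => j; rewrite !finset.inE.
  by rewrite !mxE; case: (j \in S) => //; rewrite subrr eqxx.
pose M := #|{ffun {set 'I_m} -> 'I_N}|.
have Mgt0 : (0 < M)%N.
  rewrite /M card_ffun card_ord expn_gt0 /N muln_gt0 /=.
  rewrite -cardsT card_gt0; apply/orP; left; apply/set0Pn.
  by exists finset.set0; rewrite finset.inE.
have leM w : (\sum_c (w \in
    [set w | run (D i w) (erase S (X c)) = X c ord0 i]%classic) <= M %/ 2)%N.
  rewrite leq_divRL //.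
  have := @card_lucky F m q S i N u (fun Q h => ((uP Q).2 h).1)
    (fun Q j h => ((uP Q).2 h).2 j) (D i w) (fun y => readP y i w).
  rewrite {2}/N mulnA [X in (X <= _)%N]mulnC leq_pmul2l; last first.
    rewrite -cardsT card_gt0; apply/set0Pn.
    by exists finset.set0; rewrite finset.inE.
  apply: leq_trans; rewrite leq_mul2r /= -sum1_card [leqRHS]big_mkcond /=.
  by apply: leq_sum => c _; rewrite finset.inE; case: eqP => [_|nrun];
    by [rewrite leq_b1|rewrite memNset].
have := sum_probability_le P (fun c => (succ c).1) leM.
rewrite leNgt => /negP; apply.
have : (\sum_(c : {ffun {set 'I_m} -> 'I_N}) (3%:R / 4%:R : R)%:E <= \sum_c P
    [set w | run (D i w) (erase S (X c)) = X c ord0 i]%classic)%E.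
  by apply: lee_sum => c _; case: (succ c).
apply: lt_le_trans; rewrite sumEFin lte_fin sumr_const -/M.
have : (M %/ 2 * 2)%:R <= M%:R :> R by rewrite ler_nat leq_trunc_div.
have : 0 < M%:R :> R by rewrite ltr0n.
by rewrite natrM -[_ *+ M]mulr_natr; lra.
Qed.

(** * Matrix scaling and the dimension bound for design matrices *)

Lemma ln2_ge_half (R : realType) : 2^-1 <= ln (2 : R).
Proof.
have := @le_ln1Dx R (- 2^-1).
have -> : 1 + - 2^-1 = (2 : R)^-1 by field.
rewrite lnV ?posrE // => /(_ _); lra.
Qed.

Section Scaling.
Variables (R : realType) (I T : finType).
Variables (w : T -> R) (A : T -> I -> R) (o : T -> I) (k : R).

Hypothesis w_ge0 : forall r, 0 <= w r.
Hypothesis A_ge0 : forall r l, 0 <= A r l.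
Hypothesis A_owner : forall r, w r != 0 -> 0 < A r (o r).
Hypothesis k_gt0 : 0 < k.

Let c l := \sum_(r | o r == l) w r.
Let S r (b : I -> R) := \sum_l A r l * b l.
(** In the variable [ln (b l)] the derivative is [c l] minus the scaled column sum at [l], so
    critical points balance every column. *)
Let F (b : I -> R) := \sum_l c l * ln (b l) - \sum_r w r * ln (S r b).

Let S_ge_owner r b : (forall l, 0 < b l) -> A r (o r) * b (o r) <= S r b.
Proof.
move=> b0; rewrite /S (bigD1 (o r)) //= lerDl; apply: sumr_ge0 => l _.
by rewrite mulr_ge0 // ltW.
Qed.

Let S_gt0 r b : (forall l, 0 < b l) -> w r != 0 -> 0 < S r b.
Proof.
by move=> b0 /A_owner ?; apply: lt_le_trans (S_ge_owner r b0); rewrite mulr_gt0.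
Qed.

Let F_le b : (forall l, 0 < b l) -> F b <= \sum_r w r * - ln (A r (o r)).
Proof.
move=> b0; have -> : F b = \sum_r w r * (ln (b (o r)) - ln (S r b)).
  under [RHS]eq_bigr do rewrite mulrBr.
  rewrite sumrB; congr (_ - _).
  rewrite [RHS](partition_big o xpredT) //=; apply: eq_bigr => l _.
  by rewrite /c mulr_suml; apply: eq_bigr => r /eqP ->.
apply: ler_sum => r _; have [->|wr] := eqVneq (w r) 0; first by rewrite !mul0r.
rewrite ler_wpM2l // lerBlDr -lerBlDl opprK -lnM ?posrE ?A_owner //.
by rewrite mulrC ler_ln ?posrE ?S_gt0 ?S_ge_owner // mulr_gt0 ?A_owner.
Qed.

(* [b] nearly maximizes the potential [F], which is bounded above
   because each row sum dominates its owner's term; if the column sum at [l]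
   were too small, doubling [b l] would raise [F] above its supremum. *)
Lemma exists_scaling : exists b : I -> R, (forall l, 0 < b l) /\
  forall l, k <= \sum_(r | o r == l) w r ->
    (\sum_(r | o r == l) w r) / 4 <=
    \sum_r w r * (A r l * b l / \sum_l' A r l' * b l').
Proof.
pose E := [set F b | b in [set b | forall l, 0 < b l]]%classic.
have supE : has_sup E.
  split; first by exists (F (fun=> 1)); exists (fun=> 1).
  by exists (\sum_r w r * - ln (A r (o r))) => _ [b b0 <-]; exact: F_le.
(* Doubling [b l] gains at least [c l / 2] and costs at most the scaled column sum. Being within
   [k / 4] of the supremum, with [k <= c l], leaves a column sum of at least [c l / 4]. *)
have k4 : 0 < k / 4 by rewrite divr_gt0.
have [_ [b b0 <-] Fb] := sup_adherent k4 supE.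
exists b; split=> // l kl.
pose b' l' := if l' == l then 2 * b l else b l'.
have b'0 l' : 0 < b' l' by rewrite /b'; case: eqP => // _; rewrite mulr_gt0.
have Fb' : F b' <= sup E by apply: sup_ubound => //; [case: supE|exists b'].
have SE r : S r b' = S r b + A r l * b l.
  rewrite /S (bigD1 l) //= [in RHS](bigD1 l) //= /b' eqxx.
  rewrite (eq_bigr (fun l' => A r l' * b l')) => [|l' /negPf ->] //.
  ring.
have cE : \sum_l' c l' * ln (b' l') = \sum_l' c l' * ln (b l') + c l * ln 2.
  rewrite (bigD1 l) //= [in RHS](bigD1 l) //= /b' eqxx.
  rewrite (eq_bigr (fun l' => c l' * ln (b l'))) => [|l' /negPf ->] //.
  by rewrite lnM ?posrE // mulrDr; ring.
have leS : \sum_r w r * ln (S r b') <=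
    \sum_r w r * ln (S r b) + \sum_r w r * (A r l * b l / S r b).
  rewrite -big_split /=; apply: ler_sum => r _.
  have [->|wr] := eqVneq (w r) 0; first by rewrite !mul0r addr0.
  have S0 := S_gt0 b0 wr.
  have p0 : 0 <= A r l * b l / S r b.
    by rewrite !mulr_ge0 ?invr_ge0 // ltW.
  rewrite -mulrDr ler_wpM2l // SE.
  have -> : S r b + A r l * b l = S r b * (1 + A r l * b l / S r b).
    by field; rewrite gt_eqF.
  rewrite lnM ?posrE ?lerD2l ?le_ln1Dx //; lra.
move: Fb Fb'; rewrite /F cE -/(c l) => Fb Fb'.
have := ln2_ge_half R; rewrite -/(c l) in kl.
have : c l * 2^-1 <= c l * ln 2 by rewrite ler_wpM2l ?ln2_ge_half //; lra.
rewrite -/(S _ _); move: leS.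
set X := \sum_r w r * (A r l * b l / S r b).
move: Fb Fb' kl; move: (c l * ln 2) (c l) (sup E) X => cln cl supF X.
move: (\sum_r _ * _) (\sum_r _ * _) (\sum_l _ * _) => s' s t.
lra.
Qed.

End Scaling.

(** * Sparse relations annihilated by a matrix with orthonormal rows *)

Section Hermitian.
Local Open Scope sesquilinear_scope.
Variables (C : numClosedFieldType) (T : finType) (d n : nat).
Variables (U : 'M[C]_(d, n)) (w : T -> C) (a : T -> 'I_n -> C) (k t : C).

Hypothesis U_unitary : U *m (U ^t*) = 1%:M.
Hypothesis w_ge0 : forall r, 0 <= w r.
Hypothesis k_gt0 : 0 < k.
Hypothesis t_gt0 : 0 < t.
Hypothesis U_ker : forall r p, w r != 0 -> \sum_l U p l * a r l = 0.
Hypothesis a_neq0 : forall r, w r != 0 -> exists l, a r l != 0.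
Hypothesis pair_le : forall l j, l != j ->
  \sum_(r | (a r l != 0) && (a r j != 0)) w r <= t.

Let rho r := \sum_l `|a r l| ^+ 2.

Hypothesis column_ge : forall l, (exists p, U p l != 0) ->
  k <= \sum_r w r * (`|a r l| ^+ 2 / rho r).

(** An orthogonal projection of rank [d]: its trace and its squared Frobenius norm both equal
    [d]. *)
Let P : 'M[C]_n := (U ^t*) *m U.

Let P_diag l : P l l = \sum_p `|U p l| ^+ 2.
Proof.
by rewrite /P !mxE; apply: eq_bigr => p _; rewrite !mxE mulrC -normCK.
Qed.

Let P_trace : \sum_l P l l = d%:R.
Proof. by rewrite -/(\tr P) /P mxtrace_mulC U_unitary mxtrace1. Qed.

Let P_norm : \sum_l \sum_j `|P l j| ^+ 2 = d%:R.
Proof.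
rewrite -P_trace -/(\tr P).
have PP : P *m (P ^t*) = P.
  rewrite /P trmx_mul map_mxM mulmxA -[_ *m U *m _]mulmxA.
  have -> : (U ^t*) ^t* = U.
    by rewrite trmxCK.
  by rewrite U_unitary mulmx1.
rewrite -[in RHS]PP; apply: eq_bigr => l _; rewrite mxE; apply: eq_bigr => j _.
by rewrite !mxE normCK.
Qed.

Let rho_gt0 r : w r != 0 -> 0 < rho r.
Proof.
move=> /a_neq0[l al]; rewrite /rho (bigD1 l) //=.
rewrite ltr_wpDr ?exprn_gt0 ?normr_gt0 //.
by apply: sumr_ge0 => j _; rewrite exprn_ge0.
Qed.

(** The vector [a r] is in the kernel of [P], so its quadratic form vanishes and the nonnegative
    diagonal part is minus the off-diagonal part. *)
Let diag_le r : w r != 0 -> \sum_l `|a r l| ^+ 2 * P l l <=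
  \sum_l \sum_(j | j != l) `|a r l| * `|a r j| * `|P l j|.
Proof.
move=> wr.
have : \sum_l \sum_j (a r l)^* * a r j * P l j = 0.
  transitivity (\sum_p (\sum_l U p l * a r l)^* * (\sum_j U p j * a r j)).
    rewrite (eq_bigr (fun p => \sum_l \sum_j
        (a r l)^* * a r j * ((U p l)^* * U p j))); last first.
      move=> p _; rewrite rmorph_sum /= mulr_suml; apply: eq_bigr => l _.
      rewrite mulr_sumr; apply: eq_bigr => j _; rewrite rmorphM; ring.
    rewrite [RHS]exchange_big /=; apply: eq_bigr => l _.
    rewrite [RHS]exchange_big /=; apply: eq_bigr => j _.
    rewrite /P !mxE mulr_sumr; apply: eq_bigr => p _.
    by rewrite !mxE.
  by rewrite big1 // => p _; rewrite U_ker // mulr0.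
rewrite (eq_bigr (fun l => `|a r l| ^+ 2 * P l l +
    \sum_(j | j != l) (a r l)^* * a r j * P l j)); last first.
  by move=> l _; rewrite (bigD1 l) //= [_^* * _]mulrC -normCK.
rewrite big_split /= => /eqP; rewrite addr_eq0 => /eqP eqD.
have D0 : 0 <= \sum_l `|a r l| ^+ 2 * P l l.
  apply: sumr_ge0 => l _; rewrite mulr_ge0 ?exprn_ge0 // P_diag.
  by apply: sumr_ge0 => p _; rewrite exprn_ge0.
rewrite -(ger0_norm D0) eqD normrN.
apply: le_trans (ler_norm_sum _ _ _) _; apply: ler_sum => l _.
apply: le_trans (ler_norm_sum _ _ _) _; apply: ler_sum => j _.
by rewrite !normrM norm_conjC.
Qed.

Let AM_GM (x y mu : C) : 0 <= x -> 0 <= y -> 0 < mu ->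
  x * y *+ 2 <= mu * x ^+ 2 + y ^+ 2 / mu.
Proof.
move=> x0 y0 mu0; rewrite -subr_ge0.
have -> : mu * x ^+ 2 + y ^+ 2 / mu - x * y *+ 2 = (mu * x - y) ^+ 2 / mu.
  by field; rewrite gt_eqF.
apply: divr_ge0; last exact: ltW.
rewrite real_exprn_even_ge0 //.
by rewrite rpredB ?rpredM ?ger0_real // ltW.
Qed.

Let row_le r mu : 0 < mu ->
  (w r * ((\sum_l `|a r l| ^+ 2 * P l l) / rho r)) *+ 2 <=
  mu * w r + \sum_l \sum_(j | j != l)
     (if (a r l != 0) && (a r j != 0) then w r else 0) * (`|P l j| ^+ 2 / mu).
Proof.
move=> mu0; have [wr0|wr] := eqVneq (w r) 0.
  rewrite wr0 mul0r mul0rn mulr0 add0r; apply: sumr_ge0 => l _.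
  by apply: sumr_ge0 => j _; rewrite if_same mul0r.
have r0 := rho_gt0 wr.
(* [x] has Frobenius norm 1, so AM-GM charges the row [mu] times its weight, plus the off-diagonal
   squares of [P] on its support divided by [mu]. *)
pose x l j := `|a r l| * `|a r j| / rho r.
have x0 l j : 0 <= x l j by rewrite !mulr_ge0 // invr_ge0 ltW.
have leD : (\sum_l `|a r l| ^+ 2 * P l l) / rho r <=
    \sum_l \sum_(j | j != l) x l j * `|P l j|.
  rewrite ler_pdivrMr // (le_trans (diag_le wr)) // mulr_suml.
  apply: ler_sum => l _; rewrite mulr_suml; apply: ler_sum => j _.
  by rewrite /x [leRHS]mulrAC divfK ?gt_eqF.
have sum_x : \sum_l \sum_j x l j ^+ 2 = 1.
  have -> : \sum_l \sum_j x l j ^+ 2 = (rho r * rho r) / rho r ^+ 2.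
    rewrite [in RHS]/rho !mulr_suml; apply: eq_bigr => l _.
    rewrite mulr_sumr mulr_suml; apply: eq_bigr => j _.
    by rewrite /x expr_div_n exprMn.
  by rewrite -expr2 divff // expf_neq0 // gt_eqF.
pose ind l j : C := if (a r l != 0) && (a r j != 0) then 1 else 0.
have le1 : (\sum_l \sum_(j | j != l) x l j * `|P l j|) *+ 2 <=
    mu * (\sum_l \sum_j x l j ^+ 2) +
    \sum_l \sum_(j | j != l) ind l j * (`|P l j| ^+ 2 / mu).
  rewrite mulr_sumr -big_split -sumrMnl /=.
  apply: ler_sum => l _; rewrite -sumrMnl mulr_sumr.
  rewrite [X in _ <= X + _](bigD1 l) //= -addrA -big_split /=.
  rewrite -[leLHS]add0r; apply: lerD.
    by rewrite mulr_ge0 ?exprn_ge0 // ltW.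
  apply: ler_sum => j _; rewrite /ind; have [al|al] := eqVneq (a r l) 0.
    by rewrite /x al normr0 !mul0r mul0rn expr0n mulr0 addr0.
  have [aj|aj] := eqVneq (a r j) 0.
    by rewrite /x aj normr0 !mulr0 !mul0r mul0rn expr0n mulr0 addr0.
  by rewrite mul1r AM_GM.
rewrite sum_x mulr1 in le1.
have le2 : ((\sum_l `|a r l| ^+ 2 * P l l) / rho r) *+ 2 <=
    mu + \sum_l \sum_(j | j != l) ind l j * (`|P l j| ^+ 2 / mu).
  by apply: le_trans le1; rewrite lerMn2r leD orbT.
rewrite -mulrnAr (le_trans (ler_wpM2l (w_ge0 r) le2)) // mulrDr mulrC lerD2l.
rewrite mulr_sumr; apply: ler_sum => l _; rewrite mulr_sumr; apply: ler_sum => j _.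
by rewrite mulrA /ind; case: ifP; rewrite ?mulr1 ?mulr0.
Qed.

(* Positive semidefiniteness of [A^* A], with the off-diagonal part estimated
   by AM-GM, in place of a rank bound for diagonally dominant matrices. *)
Lemma unitary_design_bound : d%:R * k ^+ 2 <= t * \sum_r w r.
Proof.
(* With this [mu] the off-diagonal term is at most [k] times the squared Frobenius norm of [P], that
   is [k * d], which half of the lower bound [2 * k * d] absorbs. *)
pose mu := t / k; have mu0 : 0 < mu by rewrite divr_gt0.
have P0 l : 0 <= P l l.
  by rewrite P_diag; apply: sumr_ge0 => p _; rewrite exprn_ge0.
have lower : k * d%:R <= \sum_r w r * ((\sum_l `|a r l| ^+ 2 * P l l) / rho r).
  rewrite -P_trace mulr_sumr.
  have -> : \sum_r w r * ((\sum_l `|a r l| ^+ 2 * P l l) / rho r) =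
      \sum_l (\sum_r w r * (`|a r l| ^+ 2 / rho r)) * P l l.
    rewrite (eq_bigr (fun r => \sum_l w r * (`|a r l| ^+ 2 / rho r) * P l l)).
      by rewrite exchange_big; apply: eq_bigr => l _; rewrite mulr_suml.
    move=> r _; rewrite mulr_suml mulr_sumr; apply: eq_bigr => l _.
    by rewrite -!mulrA [P l l * _]mulrC.
  apply: ler_sum => l _.
  have [[p Up]|nU] := pselect (exists p, U p l != 0).
    by rewrite ler_wpM2r // column_ge //; exists p.
  rewrite P_diag big1 ?mulr0 // => p _.
  have [->|Up] := eqVneq (U p l) 0; first by rewrite normr0 expr0n.
  by case: nU; exists p.
have upper : (\sum_r w r * ((\sum_l `|a r l| ^+ 2 * P l l) / rho r)) *+ 2 <=
    mu * (\sum_r w r) + k * d%:R.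
  rewrite -sumrMnl; apply: le_trans (ler_sum _ (fun r _ => row_le r mu0)) _.
  rewrite big_split /= -mulr_sumr lerD2l exchange_big -P_norm mulr_sumr /=.
  apply: ler_sum => l _; rewrite exchange_big mulr_sumr /= [leRHS](bigD1 l) //=.
  rewrite -[leLHS]add0r; apply: lerD.
    by rewrite mulr_ge0 ?exprn_ge0 // ltW.
  apply: ler_sum => j jl; rewrite -mulr_suml -big_mkcond /=.
  have -> : k * `|P l j| ^+ 2 = t * (`|P l j| ^+ 2 / mu).
    by rewrite /mu; field; rewrite !gt_eqF.
  rewrite ler_wpM2r ?pair_le 1?eq_sym // divr_ge0 ?exprn_ge0 // ltW //.
have : (k * d%:R) *+ 2 <= mu * (\sum_r w r) + k * d%:R.
  by apply: le_trans upper; rewrite lerMn2r lower orbT.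
rewrite mulr2n lerD2r /mu mulrAC ler_pdivlMr //.
by rewrite -mulrA mulrC -mulrA -expr2.
Qed.
End Hermitian.

(** Scaling the columns of [a] by the square roots of [b] and those of [Y] inversely preserves the
    relations; the row space is then orthonormalized. Scaling costs a factor 4 in [k], hence 16
    after squaring. *)
Lemma design_dimension_bound (R : realType) (T : finType) (d n : nat)
    (Y : 'M[R[i]]_(d, n)) (w : T -> R) (a : T -> 'I_n -> R[i]) (o : T -> 'I_n)
    (k t : R) :
  row_free Y -> (forall r, 0 <= w r) -> 0 < k -> 0 < t ->
  (forall r p, w r != 0 -> \sum_l Y p l * a r l = 0) ->
  (forall r, w r != 0 -> a r (o r) != 0) ->
  (forall l j, l != j ->
     \sum_(r | (a r l != 0) && (a r j != 0)) w r <= t) ->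
  (forall l, (exists p, Y p l != 0) -> k <= \sum_(r | o r == l) w r) ->
  d%:R * k ^+ 2 <= 16 * t * \sum_r w r.
Proof.
move=> Yfree w0 k0 t0 Yker ao pair col.
pose A r l : R := (complex.Re (a r l)) ^+ 2 + (complex.Im (a r l)) ^+ 2.
have AE r l : (A r l)%:C%C = `|a r l| ^+ 2 by rewrite /A add_Re2_Im2.
have A0 r l : 0 <= A r l by rewrite addr_ge0 ?sqr_ge0.
have Ao r : w r != 0 -> 0 < A r (o r).
  move=> wr; rewrite lt_neqAle A0 andbT eq_sym; apply: contraNneq (ao r wr) => A00.
  by have := AE r (o r); rewrite A00 -normr_eq0 => /esym/eqP; rewrite expf_eq0.
have [b [b0 bP]] := exists_scaling w0 A0 Ao k0.
pose s l := Num.sqrt (b l).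
have s0 l : 0 < s l by rewrite sqrtr_gt0.
have sC0 l : (s l)%:C%C != 0 by rewrite fmorph_eq0 gt_eqF.
pose Y' := Y *m diag_mx (\row_l ((s l)^-1)%:C%C).
have Y'E p l : Y' p l = Y p l / (s l)%:C%C.
  by rewrite /Y' mul_mx_diag !mxE fmorphV.
have Y'free : row_free Y'.
  case/row_freeP: Yfree => B YB; apply/row_freeP.
  exists (diag_mx (\row_l (s l)%:C%C) *m B).
  rewrite mulmxA -[Y' *m _]mulmxA mulmx_diag -[RHS]YB; congr (_ *m _).
  rewrite -[RHS]mulmx1; congr (_ *m _); apply/matrixP => p q.
  by rewrite !mxE fmorphV mulVf //; exact: sC0.
pose a' r l := a r l * (s l)%:C%C.
have a'_eq0 r l : (a' r l == 0) = (a r l == 0).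
  by rewrite mulf_eq0 (negPf (sC0 l)) orbF.
have a'E r l : `|a' r l| ^+ 2 = (A r l * b l)%:C%C.
  rewrite normrM exprMn -AE rmorphM; congr (_ * _).
  rewrite ger0_norm ?ler0c ?ltW // -rmorphXn; congr _%:C%C.
  by rewrite sqr_sqrtr ?ltW.
pose U := schmidt Y'.
have le_dn : (d <= n)%N by rewrite -(eqP Y'free) rank_leq_col.
have /unitarymxP Uu := schmidt_unitarymx Y' le_dn.
have /submxP[D UD] : (schmidt Y' <= Y')%MS by rewrite eqmx_schmidt_free.
have UE p l : U p l = \sum_q D p q * Y' q l by rewrite /U UD mxE.
have Uker r p : (w r)%:C%C != 0 -> \sum_l U p l * a' r l = 0.
  rewrite fmorph_eq0 => wr.
  transitivity (\sum_q D p q * \sum_l Y q l * a r l).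
    under eq_bigr do rewrite UE mulr_suml.
    rewrite exchange_big; apply: eq_bigr => q _; rewrite mulr_sumr.
    apply: eq_bigr => l _; rewrite Y'E /a' -mulrA; congr (_ * _).
    by rewrite mulrACA mulVf // mulr1.
  by rewrite big1 // => q _; rewrite Yker // mulr0.
have := @unitary_design_bound _ T d n U (fun r => (w r)%:C%C) a' (k / 4)%:C%C
  t%:C%C Uu.
have wC0 r : 0 <= (w r)%:C%C by rewrite ler0c.
have kC0 : 0 < (k / 4)%:C%C by rewrite ltcR divr_gt0.
have tC0 : 0 < t%:C%C by rewrite ltcR.
move=> /(_ wC0 kC0 tC0 Uker).
have h1 r : (w r)%:C%C != 0 -> exists l, a' r l != 0.
  by rewrite fmorph_eq0 => wr; exists (o r); rewrite a'_eq0 ao.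
have h2 l j : l != j ->
    \sum_(r | (a' r l != 0) && (a' r j != 0)) (w r)%:C%C <= t%:C%C.
  move=> lj; rewrite -rmorph_sum lecR; apply: le_trans (pair _ _ lj).
  by under eq_bigl do rewrite !a'_eq0.
have h3 l : (exists p, U p l != 0) -> (k / 4)%:C%C <=
    \sum_r (w r)%:C%C * (`|a' r l| ^+ 2 / \sum_l' `|a' r l'| ^+ 2).
  move=> [p Up]; have kl : k <= \sum_(r | o r == l) w r.
    apply: col; apply: contrapT => nY; move/eqP: Up; apply.
    rewrite UE big1 // => q _; rewrite Y'E.
    by have [->|Yq] := eqVneq (Y q l) 0; [rewrite mul0r mulr0|case: nY; exists q].
  rewrite (eq_bigr (fun r =>
      (w r * (A r l * b l / \sum_l' A r l' * b l'))%:C%C)); last first.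
    move=> r _; rewrite a'E (eq_bigr (fun l' => (A r l' * b l')%:C%C)) //.
    by rewrite -rmorph_sum -fmorphV -!rmorphM.
  rewrite -rmorph_sum lecR; apply: le_trans (bP l kl).
  by rewrite ler_pM2r.
move=> /(_ h1 h2 h3).
rewrite -rmorphXn -(rmorph_nat (real_complex R)) -rmorph_sum -!rmorphM lecR.
rewrite expr_div_n => le; have : (4 : R) ^+ 2 = 16 by ring.
move: le; set X := k ^+ 2; set W := \sum_r w r.
move=> le E; rewrite E in le.
have -> : d%:R * X = 16 * (d%:R * (X / 16)) by field.
by rewrite -mulrA ler_pM2l.
Qed.

(** * Parallel classes and lines *)

Section Dependencies.
Variables (F : fieldType) (m : nat) (K : {vspace 'rV[F]_m}).
Implicit Types (Q : {set 'I_m}) (i j k l : 'I_m).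

(** Equivalently, the coordinate functional [i] on [K] lies in the span of those in [Q]; [live] then
    says that it is nonzero. *)
Definition determines Q i : bool :=
  `[< forall x, x \in K -> (forall j, j \in Q -> x ord0 j = 0) ->
      x ord0 i = 0 >].

Definition live i := ~~ determines finset.set0 i.

Definition parallel_class i : {set 'I_m} :=
  [set j | live j && determines [set i] j]%SET.

Definition line i j : {set 'I_m} :=
  [set k | live k && determines [set i; j] k]%SET.

(** With all coefficients nonzero the relation can be solved for any of the three points, which
    makes it symmetric. Points with distinct indices may still be parallel. *)
Definition collinear i j k : bool :=
  [&& uniq [:: i; j; k], live i, live j, live k & `[< exists a b c,
    [/\ a != 0, b != 0, c != 0 & forall x, x \in K ->
        a * x ord0 i + b * x ord0 j + c * x ord0 k = 0] >]].

Lemma determinesP Q i :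
  reflect (forall x, x \in K -> (forall j, j \in Q -> x ord0 j = 0) ->
             x ord0 i = 0) (determines Q i).
Proof. exact: asboolP. Qed.

Lemma determines_trans Q Q' i : (forall j, j \in Q -> determines Q' j) ->
  determines Q i -> determines Q' i.
Proof.
move=> QQ' /determinesP Qi; apply/determinesP => x xK x0; apply: Qi => // j jQ.
by have /determinesP := QQ' j jQ; apply.
Qed.

Lemma determines_mem Q i : i \in Q -> determines Q i.
Proof. by move=> iQ; apply/determinesP => x _; apply. Qed.

Lemma determines_sub Q Q' i : Q \subset Q' -> determines Q i -> determines Q' i.
Proof.
move=> /fintype.subsetP QQ'; apply: determines_trans => j /QQ'.
exact: determines_mem.
Qed.

Lemma not_determinesP Q i : reflect (exists x, [/\ x \in K,
  (forall j, j \in Q -> x ord0 j = 0) & x ord0 i != 0]) (~~ determines Q i).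
Proof.
apply: (iffP idP) => [nQ|[x [xK x0 xi]]]; last first.
  by apply: contraNN xi => /determinesP ->.
apply: contrapT => nx; move/negP: nQ; apply; apply/determinesP => x xK x0.
by apply/eqP; apply: contrapT => /negP xi; apply: nx; exists x.
Qed.

Lemma liveP i : reflect (exists2 x, x \in K & x ord0 i != 0) (live i).
Proof.
apply: (iffP (not_determinesP _ _)) => [[x [? _ ?]]|[x ? ?]]; exists x => //.
by split=> // j; rewrite finset.inE.
Qed.

Lemma determines1_sym i j :
  live i -> determines [set j]%SET i -> determines [set i]%SET j.
Proof.
move=> /liveP[y yK yi] /determinesP ji; apply/determinesP => x xK x0.
have yj : y ord0 j != 0.
  apply: contraNneq yi => yj; apply/eqP; apply: ji => // k.
  by rewrite finset.inE => /eqP ->.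
have := ji (x - (x ord0 j / y ord0 j) *: y).
rewrite memvB ?memvZ // => /(_ isT); rewrite !mxE (x0 i) ?finset.inE //.
move=> /(_ _)/eqP; rewrite sub0r oppr_eq0 !mulf_eq0 (negPf yi) orbF.
rewrite invr_eq0 (negPf yj) orbF => H; apply/eqP/H => k.
by rewrite finset.inE => /eqP ->; rewrite !mxE divfK // subrr.
Qed.

Lemma determines1_live i j : live i -> determines [set j]%SET i -> live j.
Proof.
move=> i_live ji; apply: contra i_live => j_dead.
by apply: determines_trans ji => k; rewrite finset.inE => /eqP ->.
Qed.

Lemma determines2_relation i j k : determines [set j; k]%SET i ->
  ~~ determines [set j]%SET i -> ~~ determines [set k]%SET i ->
  exists b c, [/\ b != 0, c != 0 & forall x, x \in K ->
    x ord0 i = b * x ord0 j + c * x ord0 k].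
Proof.
move=> /determinesP jki /not_determinesP[y [yK y0 yi]].
move=> /not_determinesP[z [zK z0 zi]].
have yj : y ord0 j = 0 by rewrite y0 ?finset.inE.
have zk : z ord0 k = 0 by rewrite z0 ?finset.inE.
have yk : y ord0 k != 0.
  apply: contraNneq yi => yk; apply/eqP; apply: jki => // l.
  by rewrite !finset.inE => /orP[] /eqP ->.
have zj : z ord0 j != 0.
  apply: contraNneq zi => zj; apply/eqP; apply: jki => // l.
  by rewrite !finset.inE => /orP[] /eqP ->.
(* Up to scaling, [z] and [y] are dual to the coordinates [j] and [k]; subtracting their parts from
   [x] leaves a word vanishing at both. *)
exists (z ord0 i / z ord0 j), (y ord0 i / y ord0 k).
split; [by rewrite mulf_neq0 ?invr_eq0|by rewrite mulf_neq0 ?invr_eq0|].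
move=> x xK; have := jki
  (x - (x ord0 j / z ord0 j) *: z - (x ord0 k / y ord0 k) *: y).
rewrite !memvB ?memvZ // => /(_ isT); rewrite !mxE => H.
have /eqP : x ord0 i - x ord0 j / z ord0 j * z ord0 i -
    x ord0 k / y ord0 k * y ord0 i = 0.
  apply: H => l; rewrite !finset.inE => /orP[] /eqP ->; rewrite !mxE.
    by rewrite yj mulr0 subr0 divfK // subrr.
  by rewrite zk mulr0 subr0 divfK // subrr.
rewrite -addrA -opprD subr_eq0 => /eqP ->.
by field; rewrite yk zj.
Qed.

Lemma collinearC i j k : collinear i j k = collinear j i k.
Proof.
suff sym i' j' : collinear i' j' k -> collinear j' i' k.
  by apply/idP/idP; exact: sym.
move: i' j' => {}i {}j.
case/and5P => /and3P[]; rewrite !inE !negb_or.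
move=> /andP[ij ik] jk _ il jl kl [a [b [c [a0 b0 c0 rel]]]].
apply/and5P; split=> //; first by rewrite /= !inE !negb_or eq_sym ij ik jk.
apply/asboolP; exists b, a, c; split=> // x xK.
by rewrite [b * _ + _]addrC rel.
Qed.

Lemma collinearCA i j k : collinear i j k = collinear i k j.
Proof.
suff sym j' k' : collinear i j' k' -> collinear i k' j'.
  by apply/idP/idP; exact: sym.
move: j' k' => {}j {}k.
case/and5P => /and3P[]; rewrite !inE !negb_or.
move=> /andP[ij ik] jk _ il jl kl [a [b [c [a0 b0 c0 rel]]]].
apply/and5P; split=> //; first by rewrite /= !inE !negb_or [k == j]eq_sym ij ik jk.
apply/asboolP; exists a, c, b; split=> // x xK.
by rewrite addrAC rel.
Qed.

Lemma collinear_determines i j k :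
  collinear i j k -> determines [set i; j]%SET k.
Proof.
case/and5P => _ _ _ _ /asboolP[a [b [c [a0 b0 c0 rel]]]].
apply/determinesP => x xK x0; have := rel x xK.
rewrite (x0 i) ?(x0 j) ?finset.inE ?eqxx ?orbT // !mulr0 !add0r => /eqP.
by rewrite mulf_eq0 (negPf c0) => /eqP.
Qed.

Lemma lineC i j : line i j = line j i.
Proof. by rewrite /line finset.setUC. Qed.

(** Given [i], each of [j] and [k] is in the span of [i] and the other. This makes the weight of a
    triple independent of the order of its points. *)
Lemma collinear_line i j k : collinear i j k -> line i j = line i k.
Proof.
suff sub j' k' : collinear i j' k' -> line i j' \subset line i k'.
  by move=> ijk; apply/eqP; rewrite finset.eqEsubset !sub // -collinearCA.
move=> ijk; apply/fintype.subsetP => l; rewrite !finset.inE => /andP[-> /=].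
apply: determines_trans => n; rewrite !finset.inE => /orP[] /eqP ->.
  by rewrite determines_mem // !finset.inE eqxx.
by rewrite collinear_determines // -collinearCA.
Qed.

Lemma line_determines i j k : live i -> live j ->
  k \in line i j -> k \notin parallel_class i -> k \notin parallel_class j ->
  ~~ determines [set i]%SET j -> collinear i j k.
Proof.
rewrite !finset.inE => il jl /andP[kl ijk]; rewrite kl /= => ik jk ij.
have [b [c [b0 c0 rel]]] := determines2_relation ijk ik jk.
apply/and5P; split=> //.
  rewrite /= !inE !negb_or andbT -andbA; apply/and3P; split.
  - by apply: contraNneq ij => ->; rewrite determines_mem // finset.inE.
  - by apply: contraNneq ik => ->; rewrite determines_mem // finset.inE.
  - by apply: contraNneq jk => ->; rewrite determines_mem // finset.inE.
apply/asboolP; exists b, c, (-1); split=> //; first by rewrite oppr_eq0 oner_eq0.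
by move=> x xK; rewrite mulN1r (rel x xK) subrr.
Qed.

Lemma parallel_class_sub_line i j : parallel_class i \subset line i j.
Proof.
apply/fintype.subsetP => k; rewrite !finset.inE => /andP[-> /=].
by apply: determines_sub; exact: finset.subsetUl.
Qed.

Lemma parallel_class_disjoint i j : live i -> ~~ determines [set j]%SET i ->
  [disjoint parallel_class i & parallel_class j].
Proof.
move=> il ji; apply/pred0P => k /=; rewrite !finset.inE.
apply/negbTE/negP => /andP[/andP[kl ik] /andP[_ jk]]; move/negP: ji; apply.
have ki := determines1_sym kl ik.
by apply: determines_trans ki => l; rewrite finset.inE => /eqP ->.
Qed.

(* The third points completing [i] and [j] form the line minus the two classes,
   so they are few only if these two classes nearly fill the line. *)
Lemma card_collinear_ge i j k : live i -> determines [set j; k]%SET i ->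
  j \notin parallel_class i -> k \notin parallel_class i ->
  (live j -> #|parallel_class i| <= #|parallel_class j|)%N ->
  (live k -> #|parallel_class i| <= #|parallel_class k|)%N ->
  (#|line i j| <= 3 * #|[set l | collinear i j l]%SET|)%N \/
  (#|line i k| <= 3 * #|[set l | collinear i k l]%SET|)%N.
Proof.
move=> il jki ji ki leij leik.
have nji : ~~ determines [set j]%SET i.
  apply: contra ji => ji; rewrite finset.inE determines1_sym // andbT.
  exact: determines1_live il ji.
have nki : ~~ determines [set k]%SET i.
  apply: contra ki => ki; rewrite finset.inE determines1_sym // andbT.
  exact: determines1_live il ki.
have jl : live j.
  apply: contra nki => j_dead; apply: determines_trans jki => l.
  rewrite !finset.inE => /orP[] /eqP ->; last by rewrite determines_mem ?finset.inE.
  by apply: determines_sub j_dead; rewrite finset.sub0set.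
have kl : live k.
  apply: contra nji => k_dead; apply: determines_trans jki => l.
  rewrite !finset.inE => /orP[] /eqP ->; first by rewrite determines_mem ?finset.inE.
  by apply: determines_sub k_dead; rewrite finset.sub0set.
have nij : ~~ determines [set i]%SET j.
  by apply: contra nji => /(determines1_sym jl).
have nik : ~~ determines [set i]%SET k.
  by apply: contra nki => /(determines1_sym kl).
have njk : ~~ determines [set k]%SET j.
  apply: contra nki => kj; apply: determines_trans jki => l.
  by rewrite !finset.inE => /orP[] /eqP -> //; rewrite determines_mem ?finset.inE.
have ijk : collinear i j k.
  rewrite collinearC collinearCA; apply: line_determines => //.
  - by rewrite finset.inE il.
  - by rewrite finset.inE il.
  - by rewrite finset.inE il.
  - by apply: contra njk => /(determines1_sym kl).
have leg j' : live j' -> ~~ determines [set i]%SET j' -> (#|line i j'| <=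
    #|[set l | collinear i j' l]%SET| + #|parallel_class i| +
    #|parallel_class j'|)%N.
  move=> j'l ij'; rewrite -addnA.
  apply: leq_trans (leq_add (leqnn _) (leq_card_setU _ _).1).
  apply: leq_trans (leq_card_setU _ _).1; apply: subset_leq_card.
  apply/fintype.subsetP => l ll; rewrite !finset.in_setU.
  have [//|lci] := boolP (l \in parallel_class i); first by rewrite orbT.
  have [//|lcj] := boolP (l \in parallel_class j'); first by rewrite !orbT.
  by rewrite finset.inE line_determines.
have le1 := leg j jl nij; have le2 := leg k kl nik.
have eqL := collinear_line ijk.
have le3 : (#|parallel_class i| + #|parallel_class j| + #|parallel_class k| <=
    #|line i j|)%N.
  have -> : (#|parallel_class i| + #|parallel_class j| + #|parallel_class k|)%N =
    #|(parallel_class i :|: parallel_class j :|: parallel_class k)%SET|.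
    rewrite !cardsU.
    have /disjoint_setI0 -> := parallel_class_disjoint il nji.
    rewrite finset.setIUl.
    have /disjoint_setI0 -> := parallel_class_disjoint il nki.
    have /disjoint_setI0 -> := parallel_class_disjoint jl njk.
    by rewrite finset.setU0 cards0 !subn0.
  apply: subset_leq_card; rewrite !finset.subUset parallel_class_sub_line lineC.
  by rewrite parallel_class_sub_line lineC eqL lineC parallel_class_sub_line.
(* If both counts of third points were below [L / 3], then [ni + nj] and [ni + nk] would exceed
   [2 * L / 3]. As the three disjoint classes fit in [L] points, this forces [ni > L / 3],
   impossible for the smallest of them. *)
have := leij jl; have := leik kl; move: le1 le2 le3; rewrite -eqL.
move: #|parallel_class i| #|parallel_class j| #|parallel_class k| #|line i j|
  #|[set l | collinear i j l]%SET| #|[set l | collinear i k l]%SET|.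
move=> ni nj nk L g1 g2 *; lia.
Qed.

End Dependencies.

(** * Weighted triples *)

Lemma sum_triples (V : nmodType) (I : finType) (f : I -> I -> I -> V) :
  \sum_(r : I * I * I) f r.1.1 r.1.2 r.2 = \sum_x \sum_y \sum_z f x y z.
Proof. by rewrite pair_bigA /= pair_bigA. Qed.

Lemma sum_mul_eq (A : pzSemiRingType) (I : finType) (f : I -> A) (i : I) :
  \sum_l f l * (l == i)%:R = f i.
Proof.
rewrite (bigD1 i) //= eqxx mulr1 big1 ?addr0 // => l /negPf ->.
by rewrite mulr0.
Qed.

(** * Symmetric weights on ordered triples *)

Section SymmetricTriples.
Variables (R : realFieldType) (I : finType) (f : I -> I -> I -> R).
Hypothesis f_ge0 : forall x y z, 0 <= f x y z.
Hypothesis fC : forall x y z, f x y z = f y x z.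
Hypothesis fCA : forall x y z, f x y z = f x z y.

(** Take [V] maximizing its inner weight minus [kappa] times its size. The full set beats the empty
    one, so [V] is nonempty. Deleting [x] brings no gain, and loses at most the triples with [x] in
    one of three positions. *)
Lemma exists_dense_subset (kappa : R) :
  kappa * #|I|%:R < \sum_x \sum_y \sum_z f x y z ->
  exists2 V : {set I}, V != finset.set0 & forall x, x \in V ->
    kappa <= 3 * \sum_(y in V) \sum_(z in V) f x y z.
Proof.
move=> lt_total.
pose tot (V : {set I}) := \sum_(x in V) \sum_(y in V) \sum_(z in V) f x y z.
pose phi (V : {set I}) := tot V - kappa * #|V|%:R.
have [V _ maxV] := @Order.TotalTheory.arg_maxP _ R _ [set: I]%SET xpredT phi isT.
have Vmax W : phi W <= phi V by exact: maxV.
exists V.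
  apply/eqP => V0; have := Vmax [set: I]%SET.
  rewrite V0 /phi /tot big_set0 cards0 mulr0 subr0 cardsT.
  rewrite (eq_bigl xpredT) => [|x]; last by rewrite finset.inE.
  rewrite (eq_bigr (fun x => \sum_y \sum_z f x y z)); first by lra.
  move=> x _; apply: eq_big => [y|y _]; first by rewrite finset.inE.
  by apply: eq_bigl => z; rewrite finset.inE.
move=> x xV; pose W := (V :\ x)%SET; have := Vmax W.
pose D := \sum_(y in V) \sum_(z in V) f x y z.
have -> : phi V = phi W + (tot V - tot W - kappa).
  have cV : #|V|%:R = 1 + #|W|%:R :> R by rewrite (cardsD1 x V) xV natrD.
  by rewrite /phi cV; ring.
suff : tot V - tot W <= 3 * D by rewrite /D; lra.
have le1 : \sum_(y in W) \sum_(z in V) f x y z <= D.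
  rewrite /D [leRHS](big_setD1 x xV) /= -/W lerDr.
  by apply: sumr_ge0 => z _.
have le2 : \sum_(y in W) \sum_(z in W) f x y z <= D.
  apply: le_trans le1; apply: ler_sum => y _.
  by rewrite [leRHS](big_setD1 x xV) /= -/W lerDr.
rewrite /tot (big_setD1 x xV) /= -/W -/D.
rewrite (eq_bigr (fun y => \sum_(z in V) f x y z + (\sum_(z in W) f x y z +
   \sum_(z in W) \sum_(u in W) f y z u))); last first.
  move=> y _; rewrite [LHS](big_setD1 x xV) /= -/W; congr (_ + _).
    by apply: eq_bigr => z _; rewrite fC.
  rewrite -big_split /=; apply: eq_bigr => z _.
  by rewrite [LHS](big_setD1 x xV) /= -/W fCA fC.
rewrite !big_split /=; lra.
Qed.

Hypothesis f_pair : forall x y, \sum_z f x y z <= 1.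

Let pair12 l j : \sum_x \sum_y \sum_z ((x == l) && (y == j))%:R * f x y z <= 1.
Proof.
rewrite (eq_bigr (fun x => (\sum_z f x j z) * (x == l)%:R)).
  by rewrite sum_mul_eq.
move=> x _; have /= <- := sum_mul_eq (fun y => (\sum_z f x y z) * (x == l)%:R) j.
apply: eq_bigr => y _; rewrite !mulr_suml; apply: eq_bigr => z _.
by rewrite -mulnb natrM; ring.
Qed.

Let pair13 l j : \sum_x \sum_y \sum_z ((x == l) && (z == j))%:R * f x y z <= 1.
Proof.
apply: le_trans (pair12 l j); apply: ler_sum => x _; rewrite exchange_big /=.
by apply: ler_sum => z _; apply: ler_sum => y _; rewrite fCA.
Qed.

Let pair23 l j : \sum_x \sum_y \sum_z ((y == l) && (z == j))%:R * f x y z <= 1.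
Proof.
apply: le_trans (pair13 l j); rewrite exchange_big /=.
by apply: ler_sum => y _; apply: ler_sum => x _; apply: ler_sum => z _; rewrite fC.
Qed.

(** Being different, [l] and [j] occupy two distinct positions; each of the six ordered choices
    contributes at most 1 by symmetry. *)
Lemma sum_pair_le6 l j : l != j ->
  \sum_(r : I * I * I | (l \in [:: r.1.1; r.1.2; r.2]) &&
      (j \in [:: r.1.1; r.1.2; r.2])) f r.1.1 r.1.2 r.2 <= 6.
Proof.
move=> lj; have nlj x : ~~ ((x == l) && (x == j)).
  by apply/negP => /andP[/eqP xl /eqP xj]; rewrite -xl xj eqxx in lj.
pose N x y z : nat := (((x == l) && (y == j)) + ((x == l) && (z == j)) +
  ((y == l) && (z == j)) + ((x == j) && (y == l)) + ((x == j) && (z == l)) +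
  ((y == j) && (z == l)))%N.
apply: (@le_trans _ _ (\sum_x \sum_y \sum_z (N x y z)%:R * f x y z)).
  rewrite -(sum_triples (fun x y z => (N x y z)%:R * f x y z)) big_mkcond /=.
  apply: ler_sum => -[[x y] z] _ /=; rewrite !inE.
  case: ifP => [H|_]; last by rewrite mulr_ge0.
  rewrite ler_peMl // ler1n; move: H (nlj x) (nlj y) (nlj z); rewrite /N.
  rewrite ![l == _]eq_sym ![j == _]eq_sym.
  by case: (x == l); case: (y == l); case: (z == l);
     case: (x == j); case: (y == j); case: (z == j).
rewrite (eq_bigr (fun x => \sum_y \sum_z ((x == l) && (y == j))%:R * f x y z +
  \sum_y \sum_z ((x == l) && (z == j))%:R * f x y z +
  \sum_y \sum_z ((y == l) && (z == j))%:R * f x y z +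
  \sum_y \sum_z ((x == j) && (y == l))%:R * f x y z +
  \sum_y \sum_z ((x == j) && (z == l))%:R * f x y z +
  \sum_y \sum_z ((y == j) && (z == l))%:R * f x y z)); last first.
  move=> x _; rewrite -!big_split /=; apply: eq_bigr => y _.
  rewrite -!big_split /=; apply: eq_bigr => z _.
  by rewrite /N !natrD !mulrDl.
rewrite !big_split /=.
have := pair12 l j; have := pair13 l j; have := pair23 l j.
have := pair12 j l; have := pair13 j l; have := pair23 j l.
lra.
Qed.

End SymmetricTriples.

(** * The total weight supplied by decodability *)

Section TripleWeights.
Variables (R : realType) (F : fieldType) (m : nat) (K : {vspace 'rV[F]_m}).
Implicit Types i j k : 'I_m.

(* Giving every collinear triple the inverse of the number of points on its
   line makes each pair of points have total weight at most one. *)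
Definition triple_weight i j k : R :=
  if collinear K i j k then (#|line K i j|%:R)^-1 else 0.

(** Erasing these forces the live points used to decode [i] to have classes at least as large as
    that of [i]. *)
Definition smaller_class i : {set 'I_m} :=
  [set j | live K j && (#|parallel_class K j| < #|parallel_class K i|)%N]%SET.

(** When the line is nonempty, the condition says that the pair carries weight at least 1/3. *)
Definition rich i : {set 'I_m} :=
  [set j | (#|line K i j| <= 3 * #|[set l | collinear K i j l]%SET|)%N]%SET.

Lemma triple_weight_ge0 i j k : 0 <= triple_weight i j k.
Proof. by rewrite /triple_weight; case: ifP => // _; rewrite invr_ge0. Qed.

Lemma triple_weightC i j k : triple_weight i j k = triple_weight j i k.
Proof. by rewrite /triple_weight collinearC lineC. Qed.

Lemma triple_weightCA i j k : triple_weight i j k = triple_weight i k j.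
Proof.
rewrite /triple_weight collinearCA; case: ifP => // ikj.
by rewrite (collinear_line ikj).
Qed.

Lemma triple_weight_pair i j : \sum_k triple_weight i j k =
  #|[set l | collinear K i j l]%SET|%:R / #|line K i j|%:R.
Proof.
rewrite /triple_weight -big_mkcond /= [RHS]mulr_natl -[RHS]sumr_const.
by apply: eq_bigl => k; rewrite finset.inE.
Qed.

Lemma triple_weight_pair_le1 i j : \sum_k triple_weight i j k <= 1.
Proof.
rewrite triple_weight_pair; have [->|] := posnP #|line K i j|.
  by rewrite invr0 mulr0.
rewrite -(ltr0n R) => L0; rewrite ler_pdivrMr // mul1r ler_nat.
apply: subset_leq_card; apply/fintype.subsetP => k; rewrite !finset.inE => ijk.
by rewrite (collinear_determines ijk) andbT; case/and5P: ijk.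
Qed.

Lemma triple_weight_degree i : live K i ->
  #|rich i|%:R / 3 <= \sum_j \sum_k triple_weight i j k.
Proof.
move=> il; rewrite [leLHS]mulr_natl -[leLHS]sumr_const big_mkcond /=.
apply: ler_sum => j _; rewrite finset.inE triple_weight_pair.
case: ifP => [le3|_]; last by rewrite divr_ge0.
have L0 : 0 < #|line K i j|%:R :> R.
  rewrite ltr0n card_gt0; apply/set0Pn; exists i.
  by rewrite finset.inE il determines_mem // !finset.inE eqxx.
rewrite ler_pdivlMr // mulrC ler_pdivrMr // -[3]/(3%:R) -natrM ler_nat.
by rewrite mulnC.
Qed.

Variable delta : R.
Hypothesis decodable : forall i (S : {set 'I_m}), #|S|%:R <= delta * m%:R ->
  exists Q : {set 'I_m},
    [/\ (#|Q| <= 2)%N, [disjoint Q & S] & determines K Q i].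

(** Erase all three sets. Were they small in total, at most two surviving points would determine
    [i], and [card_collinear_ge] would make one of them rich, hence erased. *)
Lemma lt_smaller_rich i : live K i -> delta * m%:R <
  #|smaller_class i|%:R + #|parallel_class K i|%:R + #|rich i|%:R.
Proof.
move=> il; rewrite ltNge; apply/negP => le_dm.
pose S := (smaller_class i :|: parallel_class K i :|: rich i)%SET.
have [|Q [Q2 /pred0P QS Qi]] := @decodable i S.
  apply: le_trans le_dm; rewrite -!natrD ler_nat /S.
  apply: leq_trans (leq_card_setU _ _).1 _; rewrite leq_add2r.
  exact: (leq_card_setU _ _).1.
have [j [k [jQ kQ Qjk]]] :
    exists j k, [/\ j \in Q, k \in Q & Q \subset [set j; k]%SET].
  have [Q0|/set0Pn[j jQ]] := eqVneq Q finset.set0.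
    by move: il; rewrite /live -Q0 Qi.
  have [Qj|/set0Pn[k]] := eqVneq (Q :\ j)%SET finset.set0.
    exists j, j; split=> //; apply/fintype.subsetP => k kQ.
    rewrite !finset.inE orbb; apply: contraT => kj.
    by have := finset.in_set0 k; rewrite -Qj !finset.inE kj kQ.
  rewrite !finset.inE => /andP[kj kQ]; exists j, k; split=> //.
  suff -> : [set j; k]%SET = Q by [].
  apply/eqP; rewrite eqEcard cards2 eq_sym kj Q2 andbT.
  by apply/fintype.subsetP => l; rewrite !finset.inE => /orP[] /eqP ->.
have jki := determines_sub Qjk Qi.
have notS l : l \in Q -> [/\ l \notin parallel_class K i, l \notin rich i &
    live K l -> (#|parallel_class K i| <= #|parallel_class K l|)%N].
  move=> lQ; have := QS l; rewrite /= lQ /= /S !finset.in_setU => /negbT.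
  rewrite !negb_or -andbA => /and3P[ls -> ->]; split=> // ll.
  by move: ls; rewrite finset.inE ll /= -leqNgt.
have [jp jr jc] := notS j jQ; have [kp kr kc] := notS k kQ.
have [H|H] := card_collinear_ge il jki jp kp jc kc.
  by rewrite finset.inE H in jr.
by rewrite finset.inE H in kr.
Qed.

(** Erasing all live coordinates would leave only zero functionals, which determine no live
    coordinate. *)
Lemma card_live : (exists i, live K i) ->
  delta * m%:R < #|[set i | live K i]%SET|%:R.
Proof.
move=> [i il]; rewrite ltNge; apply/negP => le_dm.
have [Q [_ /pred0P Ql Qi]] := decodable i le_dm.
move/negP: il; apply; apply: determines_trans Qi => j jQ.
by have := Ql j; rewrite /= jQ finset.inE /= => /negbFE.
Qed.

Hypothesis delta_gt0 : 0 < delta.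

(** If some live point fails the bound, take one with the smallest class: all live points of
    strictly smaller class satisfy it, and there are more than [delta * m / 3] of them. *)
Lemma card_small_classes : (exists i, live K i) -> delta * m%:R / 3 <=
  #|[set i | live K i && (#|smaller_class i|%:R <= delta * m%:R / 3)]%SET|%:R.
Proof.
move=> exl; set L0 := [set i | _]%SET.
have dm0 : 0 <= delta * m%:R by rewrite mulr_ge0 // ltW.
have [/existsP[i0 i0P]|/existsPn all_in] :=
    boolP [exists i, live K i && (i \notin L0)]; last first.
  have live_le : (#|[set i | live K i]%SET| <= #|L0|)%N.
    apply: subset_leq_card; apply/fintype.subsetP => i; rewrite finset.inE => il.
    by have := all_in i; rewrite il /= negbK.
  apply: (@le_trans _ _ #|[set i | live K i]%SET|%:R); last by rewrite ler_nat.
  by have := card_live exl; lra.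
have [i /andP[il iL0] imin] := @arg_minnP _ i0
  (fun i => live K i && (i \notin L0)) (fun i => #|parallel_class K i|) i0P.
apply: (@le_trans _ _ #|smaller_class i|%:R).
  by move: iL0; rewrite finset.inE il /= -ltNge => /ltW.
rewrite ler_nat; apply: subset_leq_card; apply/fintype.subsetP => j.
rewrite finset.inE => /andP[jl]; rewrite ltnNge; apply: contraNT => jL0.
by apply: imin; rewrite jl.
Qed.

Lemma total_weight_ge : (exists i, live K i) ->
  (forall i, live K i -> #|parallel_class K i|%:R <= delta * m%:R / 3) ->
  (delta * m%:R) ^+ 2 / 27 <= \sum_i \sum_j \sum_k triple_weight i j k.
Proof.
move=> exl light; have := card_small_classes exl; set L0 := [set i | _]%SET.
move=> leL0; have dm0 : 0 <= delta * m%:R by rewrite mulr_ge0 // ltW.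
(* For a point of [L0] the smaller classes and its own class take at most [delta * m / 3] each, so
   more than [delta * m / 3] rich partners remain, each worth at least 1/3. *)
apply: (@le_trans _ _ (\sum_(i in L0) delta * m%:R / 9)).
  rewrite sumr_const -[leRHS]mulr_natl.
  have -> : (delta * m%:R) ^+ 2 / 27 = delta * m%:R / 3 * (delta * m%:R / 9).
    by field.
  by rewrite ler_wpM2r // divr_ge0.
rewrite big_mkcond /=; apply: ler_sum => i _; case: ifP; last first.
  by move=> _; apply: sumr_ge0 => j _; apply: sumr_ge0 => k _;
     exact: triple_weight_ge0.
rewrite finset.inE => /andP[il small].
apply: le_trans (triple_weight_degree il).
have := lt_smaller_rich il; have := light i il; lra.
Qed.

End TripleWeights.

(** * Low-rank subsets and induction *)

(* [96 = 16 * 6] comes from [design_dimension_bound] with pair weights at most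
   [6], and [delta ^+ 2 * m / 162] bounds the degrees in the extremal subset. *)
Definition lcc_constant (R : realType) : R := 96 * 162 ^+ 2.

Lemma lcc_constant_gt0 (R : realType) : 0 < lcc_constant R.
Proof. by rewrite mulr_gt0 ?exprn_gt0. Qed.

Lemma lcc_constant_ge3 (R : realType) : 3 <= lcc_constant R.
Proof. by rewrite /lcc_constant expr2; lra. Qed.

Section LowRankSubset.
Variables (R : realType) (m : nat).

Definition restrict (F : fieldType) (V : {set 'I_m}) : 'End('rV[F]_m) :=
  linfun (mulmxr (diag_mx (\row_j (j \in V)%:R))).

Lemma restrictE (F : fieldType) (V : {set 'I_m}) (x : 'rV[F]_m) j :
  restrict F V x ord0 j = x ord0 j * (j \in V)%:R.
Proof. by rewrite lfunE /= mul_mx_diag !mxE. Qed.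

Lemma basis_matrix (F : fieldType) (U : {vspace 'rV[F]_m}) :
  exists2 Y : 'M[F]_(\dim U, m), row_free Y & forall p, row p Y \in U.
Proof.
pose Y := \matrix_(p < \dim U) (vbasis U)`_p.
exists Y => [|p]; last by rewrite rowK vbasis_mem // memt_nth.
rewrite -kermx_eq0; apply/rowV0P => v /sub_kermxP; rewrite mulmx_sum_row => vY.
apply/rowP => p; rewrite mxE.
have /freeP/(_ (fun p => v ord0 p)) := basis_free (vbasisP U); apply.
by rewrite -[RHS]vY; apply: eq_bigr => q _; rewrite rowK.
Qed.

(** One row of the three-sparse matrix. Distinct indices keep the entry at the first point, the
    owner of the row, nonzero; other triples get the zero row. *)
Lemma collinear_coefficients (F : fieldType) (K : {vspace 'rV[F]_m})
    (r : 'I_m * 'I_m * 'I_m) : exists a : 'I_m -> F,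
  (forall l, a l != 0 -> l \in [:: r.1.1; r.1.2; r.2]) /\
  (collinear K r.1.1 r.1.2 r.2 -> a r.1.1 != 0 /\
     forall x, x \in K -> \sum_l x ord0 l * a l = 0).
Proof.
case: r => -[i j] k /=; have [|nc] := boolP (collinear K i j k); last first.
  by exists (fun=> 0); split=> // l; rewrite eqxx.
case/and5P => /and3P[ij _ _] _ _ _ /asboolP[a [b [c [a0 _ _ rel]]]].
exists (fun l => a * (l == i)%:R + b * (l == j)%:R + c * (l == k)%:R).
split=> [l|_].
  apply: contraNT; rewrite !inE !negb_or => /and3P[/negPf-> /negPf-> /negPf->].
  by rewrite !mulr0 !addr0.
split=> [|x xK].
  move: ij; rewrite !inE negb_or => /andP[/negPf-> /negPf->].
  by rewrite eqxx mulr1 !mulr0 !addr0.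
rewrite -[RHS](rel x xK).
have pick l := sum_mul_eq (fun l => x ord0 l) l.
rewrite -(pick i) -(pick j) -(pick k) !mulr_sumr -!big_split /=.
by apply: eq_bigr => l _; ring.
Qed.

(** Either some parallel class is large, and restricting to it leaves dimension at most 1, or all
    classes are small enough for the quadratic total weight and the design bound. *)
Lemma exists_low_rank_subset (delta : R) (K : {vspace 'rV[R[i]]_m}) :
  0 < delta -> delta <= 1 ->
  (forall i (S : {set 'I_m}), #|S|%:R <= delta * m%:R ->
    exists Q : {set 'I_m},
      [/\ (#|Q| <= 2)%N, [disjoint Q & S] & determines K Q i]) ->
  (exists i, live K i) ->
  exists V : {set 'I_m}, [/\ V != finset.set0, forall i, i \in V -> live K i &
    (\dim (restrict _ V @: K)%VS)%:R * (delta ^+ 4 * m%:R) <=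
    lcc_constant R * #|V|%:R].
Proof.
move=> d0 d1 dec exl; have [i0 il0] := exl.
have m0 : 0 < m%:R :> R by rewrite ltr0n (leq_ltn_trans _ (ltn_ord i0)).
have [[i [il heavy]]|light] := pselect (exists i, live K i /\
    delta * m%:R / 3 < #|parallel_class K i|%:R).
  exists (parallel_class K i); split.
  - by apply/set0Pn; exists i; rewrite finset.inE il determines_mem ?finset.inE.
  - by move=> j; rewrite finset.inE => /andP[].
  have /liveP[y yK yi] := il.
  have dim1 : (\dim (restrict _ (parallel_class K i) @: K)%VS <= 1)%N.
    apply: (@leq_trans (\dim <[restrict _ (parallel_class K i) y]>)%VS); last first.
      by rewrite dim_vline leq_b1.
    apply: dimvS; apply/subvP => _ /memv_imgP[x xK ->]; apply/vlineP.
    exists (x ord0 i / y ord0 i); apply/rowP => j.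
    rewrite restrictE mxE restrictE.
    have [|_] := boolP (j \in parallel_class K i); last by rewrite !mulr0.
    rewrite finset.inE => /andP[_ /determinesP ij]; rewrite !mulr1.
    apply/eqP; rewrite -subr_eq0; apply/eqP.
    have := ij (x - (x ord0 i / y ord0 i) *: y).
    rewrite memvB ?memvZ // !mxE; apply => // l; rewrite finset.inE => /eqP ->.
    by rewrite !mxE divfK // subrr.
  have d4 : delta ^+ 4 <= delta by rewrite exprS ger_pMr // exprn_ile1 // ltW.
  apply: (@le_trans _ _ (1 * (delta * m%:R))); last first.
    apply: (@le_trans _ _ (3 * #|parallel_class K i|%:R)); first by lra.
    by rewrite ler_wpM2r // lcc_constant_ge3.
  apply: ler_pM; rewrite ?lern1 //; last by rewrite ler_wpM2r // ltW.
  by apply: mulr_ge0 => //; exact/exprn_ge0/ltW.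
have light' i : live K i -> #|parallel_class K i|%:R <= delta * m%:R / 3.
  by move=> il; rewrite leNgt; apply/negP => H; apply: light; exists i.
have total := total_weight_ge dec d0 exl light'.
(* Half of the lower bound on the average weight per point, to get the strict inequality of
   [exists_dense_subset]. *)
pose kappa := delta ^+ 2 * m%:R / 54.
have kappa0 : 0 < kappa by rewrite divr_gt0 ?mulr_gt0 ?exprn_gt0.
have tw0 := triple_weight_ge0 R K; have twC := triple_weightC R K.
have twCA := triple_weightCA R K.
have [|V V0 Vdeg] := exists_dense_subset tw0 twC twCA (kappa := kappa).
  rewrite card_ord; apply: lt_le_trans total.
  have : 0 < (delta * m%:R) ^+ 2 by rewrite exprn_gt0 ?mulr_gt0.
  rewrite /kappa exprMn; have -> : delta ^+ 2 * m%:R / 54 * m%:R =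
    delta ^+ 2 * m%:R ^+ 2 / 54 by field.
  by lra.
exists V; split=> // [i iV|].
  have := Vdeg i iV; rewrite leNgt; apply: contraNT => i_dead.
  rewrite big1 ?mulr0 // => j _; apply: big1 => k _; rewrite /triple_weight.
  by case: ifP => // /and5P[_ il]; rewrite il in i_dead.
have [a aP] := choice (collinear_coefficients K).
pose inV (r : 'I_m * 'I_m * 'I_m) := [&& r.1.1 \in V, r.1.2 \in V & r.2 \in V].
pose tw (r : 'I_m * 'I_m * 'I_m) : R := triple_weight R K r.1.1 r.1.2 r.2.
pose w r := if inV r then tw r else 0.
have w0 r : 0 <= w r by rewrite /w; case: ifP => // _; exact: tw0.
have wP r : w r != 0 -> inV r /\ collinear K r.1.1 r.1.2 r.2.
  rewrite /w /tw /triple_weight; case: ifP => [rV|]; last by rewrite eqxx.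
  by case: ifP => //; rewrite eqxx.
have sum_w l : \sum_(r | r.1.1 == l) w r =
    if l \in V then \sum_(j in V) \sum_(k in V) triple_weight R K l j k else 0.
  rewrite big_mkcond /=.
  rewrite (sum_triples (fun x y z => if x == l then w (x, y, z) else 0)).
  rewrite (bigD1 l) //= eqxx [X in _ + X]big1 ?addr0; last first.
    by move=> x /negPf ->; apply: big1 => y _; apply: big1.
  rewrite /w /inV /=; case: ifPn => lV; last first.
    by apply: big1 => y _; apply: big1.
  rewrite [RHS]big_mkcond; apply: eq_bigr => y _; case: ifPn => yV; last first.
    by apply: big1.
  by rewrite [RHS]big_mkcond.
have [Y Yfree YK] := basis_matrix (restrict R[i] V @: K)%VS.
have YE p : exists2 x, x \in K & forall l, Y p l = x ord0 l * (l \in V)%:R.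
  have /memv_imgP[x xK rx] := YK p; exists x => // l.
  by rewrite -restrictE -rx mxE.
have := @design_dimension_bound R _ _ m Y w a (fun r => r.1.1) (kappa / 3) 6
  Yfree w0 (divr_gt0 kappa0 (ltr0Sn _ 2)) (ltr0Sn _ 5).
have h1 r p : w r != 0 -> \sum_l Y p l * a r l = 0.
  move=> /wP[/and3P[rV1 rV2 rV3] col]; have [x xK Yx] := YE p.
  have [supp /(_ col)[_ rel]] := aP r.
  rewrite -[RHS](rel x xK); apply: eq_bigr => l _; rewrite Yx.
  have [->|/supp] := eqVneq (a r l) 0; first by rewrite !mulr0.
  by rewrite !inE => /or3P[] /eqP ->; rewrite ?rV1 ?rV2 ?rV3 mulr1.
have h2 r : w r != 0 -> a r r.1.1 != 0.
  by move=> /wP[_ col]; have [_ /(_ col)[]] := aP r.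
have h3 l j : l != j -> \sum_(r | (a r l != 0) && (a r j != 0)) w r <= 6.
  move=> lj; apply: le_trans
    (sum_pair_le6 tw0 twC twCA (triple_weight_pair_le1 R K) lj).
  rewrite big_mkcond [leRHS]big_mkcond; apply: ler_sum => r _ /=.
  have lew : w r <= tw r by rewrite /w; case: ifP => // _; exact: tw0.
  have [supp _] := aP r; case: ifP => [/andP[/supp -> /supp ->] //|_].
  by case: ifP => // _; exact: tw0.
have h4 l : (exists p, Y p l != 0) -> kappa / 3 <= \sum_(r | r.1.1 == l) w r.
  move=> [p Yp]; have [x xK Yx] := YE p; rewrite sum_w.
  have lV : l \in V by apply: contraNT Yp => /negPf lV; rewrite Yx lV mulr0.
  by rewrite lV; have := Vdeg l lV; lra.
move=> /(_ h1 h2 h3 h4).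
(* The pair bound gives each point degree at most [m]; this factor cancels one of the two in
   [kappa ^+ 2]. *)
have sumw : \sum_r w r <= #|V|%:R * m%:R.
  apply: (@le_trans _ _ (\sum_(l in V) m%:R)).
    rewrite (partition_big (fun r => r.1.1) xpredT) //= [leRHS]big_mkcond /=.
    apply: ler_sum => l _; rewrite sum_w; case: ifP => // lV.
    apply: (@le_trans _ _ (\sum_(j < m) (1 : R))); last first.
      by rewrite sumr_const card_ord.
    rewrite big_mkcond; apply: ler_sum => j _; case: ifP => // _.
    apply: le_trans (triple_weight_pair_le1 R K l j).
    rewrite big_mkcond; apply: ler_sum => k _; case: ifP => // _; exact: tw0.
  by rewrite sumr_const mulr_natl.
set D := (\dim _)%:R => leD.
have {}leD : D * (kappa / 3) ^+ 2 <= 16 * 6 * (#|V|%:R * m%:R).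
  by apply: le_trans leD _; rewrite ler_wpM2l.
have eqk : D * (kappa / 3) ^+ 2 = D * (delta ^+ 4 * m%:R) * m%:R / 162 ^+ 2.
  by rewrite /kappa; field.
rewrite -(ler_pM2r m0); move: leD; rewrite eqk ler_pdivrMr ?exprn_gt0 //.
move=> /le_trans; apply; rewrite /lcc_constant le_eqVlt; apply/orP; left.
by apply/eqP; ring.
Qed.

End LowRankSubset.

Lemma restrict_ker_live (F : fieldType) (m : nat) (K : {vspace 'rV[F]_m})
    (V : {set 'I_m}) (i : 'I_m) :
  live (K :&: lker (restrict F V))%VS i -> live K i /\ i \notin V.
Proof.
move=> /liveP[x]; rewrite memv_cap memv_ker => /andP[xK /eqP x0] xi.
split; first by apply/liveP; exists x.
apply: contraNN xi => iV; have := restrictE V x i.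
by rewrite x0 iV mulr1 mxE => <-.
Qed.

(** The dimension is that of the restriction to [V] plus that of the subcode vanishing on [V]. The
    subcode stays decodable and has at least [#|V|] fewer live coordinates, so the costs add up. *)
Lemma dim_le_card_live (R : realType) (m : nat) (delta : R) (n : nat)
    (K : {vspace 'rV[R[i]]_m}) : 0 < delta -> delta <= 1 ->
  (forall i (S : {set 'I_m}), #|S|%:R <= delta * m%:R ->
    exists Q : {set 'I_m},
      [/\ (#|Q| <= 2)%N, [disjoint Q & S] & determines K Q i]) ->
  (#|[set i | live K i]%SET| <= n)%N ->
  (\dim K)%:R * (delta ^+ 4 * m%:R) <= lcc_constant R * n%:R.
Proof.
move=> d0 d1; elim/ltn_ind: n K => n IH K dec le_n.
have [exl|noL] := pselect (exists i, live K i); last first.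
  suff -> : K = 0%VS by rewrite dimv0 mul0r mulr_ge0 // ltW ?lcc_constant_gt0.
  apply/eqP; rewrite -subv0; apply/subvP => x xK; rewrite memv0.
  apply/eqP/rowP => i; rewrite mxE; apply/eqP; apply: contrapT => /negP xi.
  by apply: noL; exists i; apply/liveP; exists x.
have [V [V0 Vlive dimV]] := exists_low_rank_subset d0 d1 dec exl.
pose K' := (K :&: lker (restrict _ V))%VS.
have leV : (#|V| <= n)%N.
  apply: leq_trans le_n; apply: subset_leq_card; apply/fintype.subsetP => i /Vlive.
  by rewrite finset.inE.
have Vgt0 : (0 < #|V|)%N by rewrite card_gt0.
have le_n' : (#|[set i | live K' i]%SET| <= n - #|V|)%N.
  rewrite leq_subRL //; apply: leq_trans le_n.
  have -> : (#|V| + #|[set i | live K' i]%SET|)%N =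
      #|(V :|: [set i | live K' i])%SET|.
    rewrite cardsU; suff -> : (V :&: [set i | live K' i])%SET = finset.set0.
      by rewrite cards0 subn0.
    apply/setP => i; rewrite !finset.inE; apply/negbTE/negP => /andP[iV].
    by move=> /restrict_ker_live[_]; rewrite iV.
  apply: subset_leq_card; apply/fintype.subsetP => i; rewrite !finset.inE.
  by move=> /orP[/Vlive //|/restrict_ker_live[]].
have dec' i (S : {set 'I_m}) : #|S|%:R <= delta * m%:R ->
    exists Q : {set 'I_m},
      [/\ (#|Q| <= 2)%N, [disjoint Q & S] & determines K' Q i].
  move=> /(dec i)[Q [Q2 QS /determinesP Qi]]; exists Q; split=> //.
  by apply/determinesP => x; rewrite memv_cap => /andP[xK _]; exact: Qi.
have := IH (n - #|V|)%N _ K' dec' le_n'.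
rewrite ltn_subrL Vgt0 (leq_trans Vgt0 leV) => /(_ isT).
rewrite natrB // -(limg_ker_dim (restrict _ V) K) -/K' natrD mulrDl.
by move: dimV; lra.
Qed.

Theorem theorem7p2 (R : realType) :
  exists K : R, 0 < K /\
    forall (delta : R), 0 < delta -> delta <= 1 ->
    forall (m : nat) (C : {vspace 'rV[R[i]]_m}),
      is_LCC 2 delta C -> (\dim C)%:R <= K / delta ^+ 9.
Proof.
exists (lcc_constant R).
split=> [|delta d0 d1 m C lccC]; first exact: lcc_constant_gt0.
(* Length zero is treated apart because [m] is cancelled at the end. *)
have [m0|m_gt0] := posnP m.
  have -> : \dim C = 0%N.
    apply/eqP; rewrite -leqn0 (leq_trans (dimvS (subvf C))) //.
    by rewrite dimvf /dim /= m0 mul1n.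
  by rewrite divr_ge0 ?exprn_ge0 // ltW ?lcc_constant_gt0.
have dec i (S : {set 'I_m}) : #|S|%:R <= delta * m%:R ->
    exists Q : {set 'I_m},
      [/\ (#|Q| <= 2)%N, [disjoint Q & S] & determines C Q i].
  move=> /(LCC_determines lccC i)[Q [Q2 QS Qi]]; exists Q; split=> //.
  exact/determinesP.
have le_m : (#|[set i | live C i]%SET| <= m)%N.
  by rewrite -[leqRHS](card_ord m) max_card.
have := dim_le_card_live d0 d1 dec le_m.
rewrite mulrA ler_pM2r ?ltr0n // => le4.
rewrite ler_pdivlMr ?exprn_gt0 //; apply: le_trans le4.
(* The bound with exponent 4 is weakened to exponent 9, using [delta <= 1]. *)
rewrite ler_wpM2l // -[9%N]/(5 + 4)%N exprD.
by rewrite ler_piMl ?exprn_ge0 ?exprn_ile1 // ltW.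
Qed.
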